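(* Let $\mathcal{C}$ be a real rational plane curve with proper rational parametrization $\phi(t)=(X(t)/W(t),Y(t)/W(t))$, let $d>0$, and assume that the offset $\mathcal{O}_d(\mathcal{C})$ is irreducible. If $(x_0,y_0)\in\mathcal{O}_d(\mathcal{C})$ is a non-isolated, real affine singularity of $\mathcal{O}_d(\mathcal{C})$, generated by $t_0\in\mathbb{R}$, then there exists $\alpha_0\in\mathbb{R}$ with $\alpha_0^2=\widehat{U}^2(t_0)+\widehat{V}^2(t_0)$ such that $(x_0,y_0)=(x(t_0,\alpha_0),y(t_0,\alpha_0))$ and $$\mathbf{sres}_1(x(t_0,\alpha_0),y(t_0,\alpha_0))=0.$$
   Context: **Curve and offset.** $X,Y,W\in\mathbb{R}[t]$ with $\gcd(X,Y,W)=1$, and $\phi(t)=(X/W,Y/W)$ is proper, i.e. injective except for finitely many values of $t$. Put $U=X'W-XW'$, $V=Y'W-YW'$, $\widehat U=U/\gcd(U,V)$, $\widehat V=V/\gcd(U,V)$. For $d>0$, $\mathcal{O}_d(\mathcal{C})$ is the Zariski closure of the set of points $$\phi_d(t)=\Big(\tfrac{X}{W}\pm d\tfrac{V}{\sqrt{U^2+V^2}},\ \tfrac{Y}{W}\mp d\tfrac{U}{\sqrt{U^2+V^2}}\Big),$$ extended by taking limits to those $t_0$ with $U^2(t_0)+V^2(t_0)=0$. A point $(x_0,y_0)$ is generated by $t_0\in\mathbb{R}$ if $W(t_0)\ne0$ and $(x_0,y_0)=\phi_d(t_0)$ for one of the two choices of sign (equivalently, $(x_0,y_0)=\phi(t_0)\pm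 d(\widehat V(t_0),-\widehat U(t_0))/\sqrt{\widehat U^2(t_0)+\widehat V^2(t_0)}$). Irreducibility of $\mathcal{O}_d(\mathcal{C})$ is equivalent to $U^2+V^2$ not being a perfect square in $\mathbb{R}[t]$. **The maps $x(t,\alpha),y(t,\alpha)$.** $x(t,\alpha)=\frac{X(t)}{W(t)}+d\frac{\widehat V(t)}{\alpha}$, $y(t,\alpha)=\frac{Y(t)}{W(t)}-d\frac{\widehat U(t)}{\alpha}$. **The polynomial $\mathbf{sres}_1$.** Let $\tilde P(x,y,t)=U(Wx-X)+V(Wy-Y)$ and $\tilde Q(x,y,t)=(Wx-X)^2+(Wy-Y)^2-d^2W^2$. Let $P,Q\in\mathbb{R}[x,y][t]$ be the polynomials obtained by dividing $\tilde P,\tilde Q$ by their $t$-contents (the content is the gcd in $\mathbb{R}[t]$ of the coefficients, seen as a polynomial in $x,y$ with coefficients in $\mathbb{R}[t]$). Let $n=\deg_t P$, $m=\deg_t Q$. The matrix $\mathbf{Sylv}_1(P,n,Q,m)$ is the $(n+m-2)\times(n+m-1)$ matrix whose rows are the coefficient vectors of $t^{m-2}P,\dots,tP,P,t^{n-2}Q,\dots,tQ,Q$ with respect to $t^{n+m-2},\dots,t,1$. The first subresultant is $\mathbf{Subres}_1(P,n,Q,m)=\mathbf{sres}_1(x,y)\,t+\mathrm{sr}(x,y)$, where $\mathbf{sres}_1$ is the determinant of the submatrix formed by the first $n+m-2$ columns, and $\mathrm{sr}$ is the determinant of the submatrix formed by the first $n+m-3$ columns and the last column. **Singularities.** For a plane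 algebraic curve defined by a square-free polynomial $f(x,y)=0$, an affine point $S$ of the curve is a singularity iff $f_x(S)=f_y(S)=0$. A place centered at $S$ is an equivalence class of irreducible local analytic parametrizations $(x(h),y(h))$ with $(x(0),y(0))=S$; it is real if some representative has real coefficients. A real singularity is non-isolated if it is the center of at least one real place. *)

(* Defs.v *)
From HB Require Import structures.
From mathcomp Require Import all_boot all_order all_algebra.
From mathcomp Require Import polyXY complex.
From mathcomp Require Import all_classical all_reals all_analysis.

Set Implicit Arguments.
Unset Strict Implicit.
Unset Printing Implicit Defensive.

Import Order.TTheory GRing.Theory Num.Theory.
Import numFieldNormedType.Exports.

Local Open Scope classical_set_scope.
Local Open Scope ring_scope.
Local Open Scope complex_scope.

(* A bivariate polynomial f : {poly {poly A}} has x as its outer and y as its  *)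
(* inner variable, so that f.[x, y] = f.[x%:P].[y], as in polyXY.              *)

Section PlaneAlgebraicSets.
Variable C : fieldType.

Definition zeros (f : {poly {poly C}}) : set (C * C) :=
  [set p | f.[p.1, p.2] = 0].

Definition zariski_closure (A : set (C * C)) : set (C * C) :=
  [set p | forall f, A `<=` zeros f -> zeros f p].

Definition zariski_closed (A : set (C * C)) : Prop := zariski_closure A = A.

Definition irreducible_set (A : set (C * C)) : Prop :=
  A !=set0 /\
  forall B D, zariski_closed B -> zariski_closed D ->
    A `<=` B `|` D -> A `<=` B \/ A `<=` D.

Definition square_free (f : {poly {poly C}}) : Prop :=
  f != 0 /\ forall g h, f = g ^+ 2 * h -> g \is a GRing.unit.

(* Over an algebraically closed field a square-free f with A = zeros f is      *)
(* unique up to a nonzero constant, so the choice of f is immaterial.         *)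
Definition singular (A : set (C * C)) (p : C * C) : Prop :=
  exists f, [/\ square_free f, A = zeros f, A p,
                (f^`()).[p.1, p.2] = 0 & (map_poly deriv f).[p.1, p.2] = 0].

End PlaneAlgebraicSets.

Section Places.
Variable C : numFieldType.

Definition psum_at0 (a : nat -> C) (g : C -> C) : Prop :=
  \forall h \near (0 : C), series (fun n => a n * h ^+ n) @ \oo --> g h.

Definition analytic_pair (g : C -> C * C) : Prop :=
  exists a b, psum_at0 a (fun h => (g h).1) /\ psum_at0 b (fun h => (g h).2).

Definition local_param (A : set (C * C)) (p : C * C) (g : C -> C * C) : Prop :=
  [/\ analytic_pair g, g 0 = p, (\forall h \near (0 : C), A (g h)) &
      ~ \forall h \near (0 : C), g h = p].

Definition param_equiv (g1 g2 : C -> C * C) : Prop :=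
  exists (b : nat -> C) (s : C -> C),
    [/\ psum_at0 b s, b 0%N = 0, b 1%N != 0 &
        \forall h \near (0 : C), g2 h = g1 (s h)].

(* Reducible parametrizations become power series in h^k, for some k > 1,     *)
(* after an analytic change of parameter.                                     *)
Definition param_irreducible (g : C -> C * C) : Prop :=
  ~ exists (k : nat) (u : C -> C * C),
      [/\ (1 < k)%N, analytic_pair u & param_equiv g (fun h => u (h ^+ k))].

Definition place (A : set (C * C)) (p : C * C) (pi : set (C -> C * C)) : Prop :=
  exists2 g, local_param A p g /\ param_irreducible g &
    pi = [set g' | local_param A p g' /\ param_equiv g g'].

End Places.

Definition real_place (R : realType) (pi : set (R[i] -> R[i] * R[i])) : Prop :=
  exists2 g, pi g & exists a b : nat -> R,
    psum_at0 (fun n => (a n)%:C) (fun h => (g h).1) /\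
    psum_at0 (fun n => (b n)%:C) (fun h => (g h).2).

Definition non_isolated (R : realType) (A : set (R[i] * R[i])) (p : R[i] * R[i])
  : Prop := exists2 pi, place A p pi & real_place pi.

Section Subresultant.
Variable A : comNzRingType.

Definition Sylv1_row (P : {poly A}) (n : nat) (Q : {poly A}) (m : nat)
    (i : nat) : {poly A} :=
  if (i < m - 1)%N then 'X^(m - 2 - i) * P
  else 'X^(n - 2 - (i - (m - 1))) * Q.

Definition Sylv1 (P : {poly A}) (n : nat) (Q : {poly A}) (m : nat)
    : 'M[A]_(n + m - 2, n + m - 1) :=
  \matrix_(i, j) (Sylv1_row P n Q m i)`_(n + m - 2 - j).

Definition Subres1_lead (P : {poly A}) (n : nat) (Q : {poly A}) (m : nat) : A :=
  \det (colsub (widen_ord (leq_sub2l (n + m) (leqnSn 1))) (Sylv1 P n Q m)).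

End Subresultant.

Section Content.
Variable R : fieldType.

(* Elements of R[t][x, y] are nested as x, then y, then t (innermost).        *)
Definition tcontent (F : {poly {poly {poly R}}}) : {poly R} :=
  \big[@gcdp R/0]_(G <- F) \big[@gcdp R/0]_(c <- G) c.

Definition tprimitive (F : {poly {poly {poly R}}}) : {poly {poly {poly R}}} :=
  map_poly (map_poly (fun c => c %/ tcontent F)) F.

(* The isomorphism R[t][x, y] -> R[x, y][t]; in the target, t is outermost.   *)
Definition to_tpoly (F : {poly {poly {poly R}}}) : {poly {poly {poly R}}} :=
  swapXY (map_poly (@swapXY R) F).

End Content.

Section Offset.
Variables (R : realType) (X Y W : {poly R}) (d : R).

Definition Upol : {poly R} := X^`() * W - X * W^`().
Definition Vpol : {poly R} := Y^`() * W - Y * W^`().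
Definition Uhat : {poly R} := Upol %/ gcdp Upol Vpol.
Definition Vhat : {poly R} := Vpol %/ gcdp Upol Vpol.

Definition toC2 (p : R * R) : R[i] * R[i] := (p.1%:C, p.2%:C).

Definition evalC (p : {poly R}) (t : R[i]) : R[i] :=
  (map_poly (real_complex R) p).[t].

(* Properness is birationality, so the parameter ranges over the complex      *)
(* numbers here.                                                              *)
Definition proper_param : Prop :=
  exists s : seq R[i], forall t1 t2 : R[i],
    t1 \notin s -> t2 \notin s -> evalC W t1 != 0 -> evalC W t2 != 0 ->
    evalC X t1 / evalC W t1 = evalC X t2 / evalC W t2 ->
    evalC Y t1 / evalC W t1 = evalC Y t2 / evalC W t2 -> t1 = t2.

Definition offset_map (neg : bool) (t : R) : R * R :=
  let r := Num.sqrt (Upol.[t] ^+ 2 + Vpol.[t] ^+ 2) in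
  (X.[t] / W.[t] + (-1) ^+ neg * d * (Vpol.[t] / r),
   Y.[t] / W.[t] - (-1) ^+ neg * d * (Upol.[t] / r)).

(* Where U^2 + V^2 vanishes, the unit normal (V, -U) / sqrt (U^2 + V^2) may    *)
(* have opposite limits from the left and from the right (at a cusp); as both *)
(* signs are allowed, both one-sided limits of each branch are generated.     *)
Definition generated_by (t : R) (p : R * R) : Prop :=
  W.[t] != 0 /\
  exists neg : bool,
    if Upol.[t] ^+ 2 + Vpol.[t] ^+ 2 != 0 then p = offset_map neg t
    else (offset_map neg s @[s --> t^'+] --> p) \/
         (offset_map neg s @[s --> t^'-] --> p).

Definition offset : set (R[i] * R[i]) :=
  zariski_closure (toC2 @` [set p | exists t, generated_by t p]).

Definition xmap (t alpha : R) : R := X.[t] / W.[t] + d * (Vhat.[t] / alpha).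
Definition ymap (t alpha : R) : R := Y.[t] / W.[t] - d * (Uhat.[t] / alpha).

Let xvar : {poly {poly {poly R}}} := 'X.
Let yvar : {poly {poly {poly R}}} := 'X%:P.
Let cst (p : {poly R}) : {poly {poly {poly R}}} := p%:P%:P.

Definition Ptilde : {poly {poly {poly R}}} :=
  cst Upol * (cst W * xvar - cst X) + cst Vpol * (cst W * yvar - cst Y).

Definition Qtilde : {poly {poly {poly R}}} :=
  (cst W * xvar - cst X) ^+ 2 + (cst W * yvar - cst Y) ^+ 2
  - cst (d ^+ 2 *: W ^+ 2).

Definition Ppol : {poly {poly {poly R}}} := to_tpoly (tprimitive Ptilde).
Definition Qpol : {poly {poly {poly R}}} := to_tpoly (tprimitive Qtilde).

Definition sres1 : {poly {poly R}} :=
  Subres1_lead Ppol (size Ppol).-1 Qpol (size Qpol).-1.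

End Offset.

(* Main.v *)
Require Import Defs.
From HB Require Import structures.
From mathcomp Require Import all_boot all_order all_algebra.
From mathcomp Require Import polyXY complex ring zify.
From mathcomp Require Import all_classical all_reals all_analysis.

Import Order.TTheory GRing.Theory Num.Theory.
Import numFieldNormedType.Exports.
Local Open Scope classical_set_scope.
Local Open Scope ring_scope.

Set Implicit Arguments.
Unset Strict Implicit.

(** Suppose that s = sres_1 does not vanish at S = (x0, y0). The Bezout identity
    for the first subresultant gives s t + r = 0 whenever P and Q vanish at
    (x, y, t), hence at every pair of a point and its generating parameter.
    Pseudo-dividing Q by s t + r yields s^k Q = q (s t + r) + g with g free of
    t; so g vanishes on the offset, and its gradient vanishes at S because a
    square-free equation of the offset divides g and is singular at S. On the
    other hand t0 is a double root of Q(S, t), which forces q(S, t0) = 0;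
    restricting the identity at t = t0 to the line through S and phi(t0) then
    contradicts the fact that the circle Q(., t0) = 0 is smooth at S. *)

(** * Divisibility in C[y][x] and the Nullstellensatz for a square-free plane curve *)

Lemma dvd_coef_root (C : fieldType) (g : C) (p : {poly {poly C}}) :
  map_poly (horner_eval g) p = 0 -> exists q, p = ('X - g%:P) *: q.
Proof.
move=> p0; exists (map_poly (fun c => c %/ ('X - g%:P)) p).
apply/polyP => i; rewrite coefZ coef_map_id0 ?div0p // mulrC divpK //.
by rewrite -root_factor_theorem /root -/(horner_eval g _) -coef_map p0 coef0.
Qed.

(* Gauss's lemma: c is a product of linear factors 'X - g, each of which is    *)
(* prime in C[y][x] and so divides h or b.                                    *)
Lemma cancel_coef (C : closedFieldType) (c : {poly C}) (a h b : {poly {poly C}}) :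
  c != 0 -> c *: a = h * b ->
  exists c1 (h1 b1 : {poly {poly C}}), [/\ c1 != 0, h = c1 *: h1 & a = h1 * b1].
Proof.
have [n] := ubnP (size c); elim: n => // n IHn in c h b * => /ltnSE le_cn c0 eq_cab.
have [/size_poly1P[u u0 cE]|] := boolP (size c == 1)%N.
  exists 1, h, (u^-1%:P *: b); split; rewrite ?oner_eq0 ?scale1r //.
  by rewrite -scalerAr -eq_cab cE scalerA -polyCM mulVf // scale1r.
case/closed_rootP => g /factor_theorem[c' cE].
have c'0 : c' != 0 by apply: contraNneq c0; rewrite cE => ->; rewrite mul0r.
have lt_c' : (size c' < n)%N.
  by rewrite (leq_trans _ le_cn) // cE size_Mmonic ?monicXsubC // size_XsubC addn2.
have L0 : 'X - g%:P != 0 by rewrite polyXsubC_eq0.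
have LI : injective ( *:%R ('X - g%:P) : {poly {poly C}} -> _).
  by move=> p q; rewrite -!mul_polyC; apply: mulfI; rewrite polyC_eq0.
have : map_poly (horner_eval g) h * map_poly (horner_eval g) b = 0.
  rewrite -rmorphM -eq_cab cE /= map_polyZ /= /horner_eval hornerM hornerXsubC subrr.
  by rewrite mulr0 scale0r.
move/eqP; rewrite mulf_eq0 => /orP[]/eqP/dvd_coef_root[q qE].
- have [|c1 [h1 [b1 [c10 h1E aE]]]] := IHn c' q b lt_c' c'0.
    apply: LI; rewrite scalerA mulrC -cE eq_cab qE.
    by rewrite scalerAl.
  exists (('X - g%:P) * c1), h1, b1; split=> //; first by rewrite mulf_neq0.
  by rewrite qE h1E scalerA.
- apply: (IHn c' h q lt_c' c'0).
  by apply: LI; rewrite scalerA mulrC -cE eq_cab qE scalerAr.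
Qed.

(** Over the ring C[y], [gcdp] divides only after multiplication by nonzero elements of C[y]. Two
    uses of [cancel_coef] remove these multipliers one after the other and leave the x-degree of the
    common factor unchanged. *)
Lemma common_factor (C : closedFieldType) (a b : {poly {poly C}}) :
  a != 0 -> ~~ coprimep a b ->
  exists h a1 b1 : {poly {poly C}}, [/\ (1 < size h)%N, a = h * a1 & b = h * b1].
Proof.
move=> a0; rewrite coprimep_def => nsz1.
set h := gcdp a b in nsz1 *.
have h0 : h != 0 by rewrite gcdp_eq0 (negPf a0).
have hda : h %| a := dvdp_gcdl a b; have hdb : h %| b := dvdp_gcdr a b.
have [[c u] /= c0 aE] := Pdiv.Idomain.dvdpP _ _ hda.
have [[e v] /= e0 bE] := Pdiv.Idomain.dvdpP _ _ hdb.
clearbody h.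
move: aE; rewrite mulrC => /(cancel_coef c0)[c1 [h1 [a1 [c10 hE aE]]]].
have : e *: b = h1 * (c1 *: v) by rewrite bE hE -scalerAr mulrC scalerAr.
move/(cancel_coef e0) => [e1 [h2 [b1 [e10 h1E bE']]]].
exists h2, (e1 *: a1), b1; split=> //; last by rewrite aE h1E -scalerAr -scalerAl.
have <- : size h = size h2 by rewrite hE h1E !size_scale.
by move: nsz1; rewrite -size_poly_eq0 in h0 *; case: (size h) h0 => [|[]].
Qed.

(** For y outside the zeros of [lead_coef a], the specialized [a] keeps its positive x-degree and
    has a root x. Hence [lead_coef a * c] vanishes at every y, and an algebraically closed field is
    infinite. *)
Lemma poly_in_y_eq0_on_zeros (C : closedFieldType) (a : {poly {poly C}}) (c : {poly C}) :
  (1 < size a)%N -> (forall x y, a.[x, y] = 0 -> c.[y] = 0) -> c = 0.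
Proof.
move=> sa ac0; have a0 : a != 0 by rewrite -size_poly_gt0 ltnW.
suff : lead_coef a * c = 0 by move/eqP; rewrite mulf_eq0 lead_coef_eq0 (negPf a0) => /eqP.
have all0 y : (lead_coef a * c).[y] = 0.
  rewrite hornerM; have [->|la0] := eqVneq (lead_coef a).[y] 0; first by rewrite mul0r.
  have sz : size (map_poly (horner_eval y) a) = size a.
    by rewrite size_poly_eq // /horner_eval -lead_coefE.
  have /closed_rootP[x /rootP ax0] : size (map_poly (horner_eval y) a) != 1%N.
    by rewrite sz neq_ltn sa orbT.
  rewrite (ac0 x y) ?mulr0 //; rewrite -ax0.
  by rewrite -[in RHS](hornerC x y) -/(horner_eval y x%:P) horner_map.
apply/eqP; apply: contraT => p0.
set p := _ * c in p0 all0.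
have /closed_nonrootP[y] := p0.
by rewrite /root all0 eqxx.
Qed.

Lemma not_unit_size (C : fieldType) (h : {poly {poly C}}) :
  (1 < size h)%N -> h \isn't a GRing.unit.
Proof. by move=> sh; rewrite poly_unitE; case: (size h) sh => [|[]]. Qed.

Lemma not_unit_polyXsubC (C : fieldType) (g : C) :
  (('X - g%:P)%:P : {poly {poly C}}) \isn't a GRing.unit.
Proof. by rewrite poly_unitE coefC /= poly_unitE size_XsubC andbF. Qed.

Lemma horner2M (C : comNzRingType) (p q : {poly {poly C}}) (x y : C) :
  (p * q).[x, y] = p.[x, y] * q.[x, y].
Proof. by rewrite !hornerM. Qed.

Lemma vanish_on_line (C : closedFieldType) (g : C) (p : {poly {poly C}}) :
  (forall x, p.[x, g] = 0) -> map_poly (horner_eval g) p = 0.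
Proof.
move=> p0; apply/eqP; apply: contraT => /closed_nonrootP[x].
rewrite /root -[x in X in X -> _](hornerC x g) -/(horner_eval g x%:P) horner_map.
by rewrite /= /horner_eval p0 eqxx.
Qed.

(* Write f = e a and g = e b and move common factors of a and b into e; none   *)
(* is shared by a and e. Once a is coprime to g over C(y), Bezout produces a  *)
(* nonzero polynomial in y alone that vanishes at all zeros of a.             *)
Lemma square_free_dvd (C : closedFieldType) (f g : {poly {poly C}}) :
  f != 0 -> (forall h k, f = h ^+ 2 * k -> h \is a GRing.unit) ->
  (forall x y, f.[x, y] = 0 -> g.[x, y] = 0) -> exists q, g = f * q.
Proof.
move=> f0 sqf fg.
(* The measure adds the size of the leading coefficient in y to the size in x, so it drops both when
   [a] loses a factor of positive x-degree and when [a] lies in C[y] and loses a linear factor. *)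
suff ind n (e a b : {poly {poly C}}) : (size a + size (lead_coef a) < n)%N ->
    f = e * a -> g = e * b -> exists q, g = f * q.
  by apply: (ind _ 1 f g); rewrite ?mul1r.
elim: n => // n IHn in e a b *; move=> /ltnSE le_n fE gE.
have /andP[e0 a0] : (e != 0) && (a != 0) by rewrite -negb_or -mulf_eq0 -fE.
have [sa|sa] := leqP (size a) 1.
  have aE := size1_polyC sa; set c := a`_0 in aE.
  have c0 : c != 0 by rewrite -polyC_eq0 -aE.
  have [/size_poly1P[u u0 cE]|] := boolP (size c == 1)%N.
    exists ((u^-1)%:P%:P * b).
    by rewrite fE gE aE cE -mulrA [_%:P * (_ * _)]mulrA -!polyCM divff // mul1r.
  case/closed_rootP => y /factor_theorem[c' cE].
  have c'0 : c' != 0 by apply: contraNneq c0; rewrite cE => ->; rewrite mul0r.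
  (* The whole line at height y lies in the zeros of [f], hence of [e * b]. So the prime 'X - y
     divides [e], which would put a square into [f], or it divides [b] and can be moved into [e]. *)
  have : map_poly (horner_eval y) e * map_poly (horner_eval y) b = 0.
    rewrite -rmorphM -gE; apply: vanish_on_line => x; apply: fg.
    by rewrite fE aE cE horner2M hornerC hornerM hornerXsubC subrr !mulr0.
  move/eqP; rewrite mulf_eq0 => /orP[]/eqP/dvd_coef_root[q qE].
    have /sqf : f = ('X - y%:P)%:P ^+ 2 * (q * c'%:P).
      by rewrite fE aE cE qE -mul_polyC polyCM; ring.
    by rewrite (negPf (not_unit_polyXsubC _)).
  apply: (IHn (('X - y%:P) *: e) c'%:P q).
  - rewrite (leq_trans _ le_n) // aE cE !lead_coefC !size_polyC -cE c0 c'0.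
    by rewrite cE size_Mmonic ?monicXsubC // size_XsubC addn2.
  - by rewrite fE aE cE -mul_polyC polyCM; ring.
  - by rewrite gE qE -!mul_polyC; ring.
have [cop|] := boolP (coprimep a (e * b)).
  have /Pdiv.Idomain.Bezout_coprimepP[[u v] /=] := cop.
  case/Pdiv.Idomain.eqpP => -[c1 c2] /= /andP[c10 c20] bez.
  suff c2E : c2 = 0 by rewrite c2E eqxx in c20.
  apply: (poly_in_y_eq0_on_zeros sa) => x y ay.
  have /(congr1 (fun p => p.[x, y])) := bez.
  have gxy : e.[x, y] * b.[x, y] = 0 by rewrite -horner2M -gE fg // fE horner2M ay mulr0.
  rewrite -!mul_polyC mulr1 horner2M !hornerD !horner2M ay gxy !mulr0 addr0 mulr0.
  by rewrite hornerC => ->.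
rewrite coprimepMr negb_and => /orP[/(common_factor a0)|/(common_factor a0)].
  move=> [h [a1 [e1 [sh aE eE]]]].
  have /sqf : f = h ^+ 2 * (e1 * a1) by rewrite fE aE eE; ring.
  by rewrite (negPf (not_unit_size sh)).
move=> [h [a1 [b1 [sh aE bE]]]].
apply: (IHn (e * h) a1 b1); rewrite -?mulrA -?aE -?bE //.
have /andP[h0 a10] : (h != 0) && (a1 != 0) by rewrite -negb_or -mulf_eq0 -aE.
rewrite (leq_trans _ le_n) // aE lead_coefM !size_mul ?lead_coef_eq0 //.
have : (0 < size (lead_coef h))%N by rewrite size_poly_gt0 lead_coef_eq0.
move: sh; move: (size h) (size a1) (size (lead_coef h)) (size (lead_coef a1)).
by move=> i j k l; lia.
Qed.

(** * The first subresultant as a combination of P and Q, and pseudo-division by it *)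

Lemma size_Sylv1_row (A : comNzRingType) (P Q : {poly A}) (n m i : nat) :
  (2 < n + m)%N -> (size P <= n.+1)%N -> (size Q <= m.+1)%N ->
  (i < n + m - 2)%N -> (size (Sylv1_row P n Q m i) <= n + m - 1)%N.
Proof.
move=> nm sP sQ ilt; rewrite /Sylv1_row; case: ifP => im;
  rewrite (leq_trans (size_polyMleq _ _)) // size_polyXn; lia.
Qed.

Lemma Sylv1_row_ideal (A : comNzRingType) (P Q : {poly A}) (n m i : nat) :
  exists u v, Sylv1_row P n Q m i = u * P + v * Q.
Proof.
rewrite /Sylv1_row; case: ifP => _; first by exists 'X^(m - 2 - i), 0; rewrite mul0r addr0.
by exists 0, 'X^(n - 2 - (i - (m - 1))); rewrite mul0r add0r.
Qed.

(* The last row of the adjugate of the square matrix defining sres_1 yields   *)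
(* the Bezout coefficients.                                                   *)
Lemma Subres1_lead_ideal (A : comNzRingType) (P Q : {poly A}) (n m : nat) :
  (2 < n + m)%N -> (size P <= n.+1)%N -> (size Q <= m.+1)%N ->
  exists u v r, u * P + v * Q = (Subres1_lead P n Q m)%:P * 'X + r%:P.
Proof.
move=> nm sP sQ.
pose M := colsub (widen_ord (leq_sub2l (n + m) (leqnSn 1))) (Sylv1 P n Q m).
have N0 : (n + m - 3 < n + m - 2)%N by lia.
pose k := Ordinal N0.
pose S := \sum_i (\adj M k i)%:P * Sylv1_row P n Q m i.
have [u [v SE]] : exists u v, S = u * P + v * Q.
  rewrite /S; elim/big_ind: _ => [|_ _ [u1 [v1 ->]] [u2 [v2 ->]]|i _].
  - by exists 0, 0; rewrite !mul0r addr0.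
  - by exists (u1 + u2), (v1 + v2); ring.
  have [u [v ->]] := Sylv1_row_ideal P Q n m i.
  by exists ((\adj M k i)%:P * u), ((\adj M k i)%:P * v); ring.
exists u, v, S`_0; rewrite -SE; apply/polyP => j.
rewrite coefD coefCM coefX coefC.
case: j => [|j] /=; first by rewrite mulr0 add0r.
rewrite addr0 eqSS coef_sum.
have [jlt|jge] := ltnP j.+1 (n + m - 1); last first.
  rewrite big1 => [|i _].
    by rewrite (_ : (j == 0)%N = false) ?mulr0 //; apply/eqP; lia.
  rewrite coefCM nth_default ?mulr0 //.
  exact: leq_trans (size_Sylv1_row nm sP sQ (ltn_ord i)) jge.
have lt_l : (n + m - 3 - j < n + m - 2)%N by lia.
(* Column [n + m - 3 - j] of [M] holds the coefficients of t^(j+1). As [\adj M *m M] is the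
   determinant times the identity, [S] has the determinant as coefficient of t and no higher
   terms. *)
transitivity ((\adj M *m M) k (Ordinal lt_l)).
  rewrite mxE; apply: eq_bigr => i _; rewrite coefCM; congr (_ * _).
  by rewrite !mxE /=; congr (_`_ _); lia.
rewrite mul_adj_mx mxE mulr_natr /Subres1_lead -/M.
have -> : (k == Ordinal lt_l) = (j == 0)%N by rewrite -val_eqE /=; apply/eqP/eqP; lia.
by [].
Qed.

Lemma linear_remainder (A : idomainType) (Q : {poly A}) (s r : A) : s != 0 ->
  exists k q g, s ^+ k *: Q = q * (s%:P * 'X + r%:P) + g%:P.
Proof.
move=> s0; set L := _ + _.
have sL : size L = 2%N by rewrite size_MXaddC polyC_eq0 (negPf s0) /= size_polyC s0.
have lcL : lead_coef L = s by rewrite lead_coefE sL coefD coefMX coefC /= coefC addr0.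
exists (Pdiv.Idomain.scalp Q L), (Pdiv.Idomain.divp Q L), (Pdiv.Idomain.modp Q L)`_0.
have := Pdiv.Idomain.divp_eq Q L; rewrite lcL => ->; congr (_ + _).
apply: size1_polyC; rewrite -ltnS -[X in (_ < X)%N]sL.
by rewrite Pdiv.Idomain.ltn_modp -size_poly_gt0 sL.
Qed.

(** * Polynomials determined by their values, and restriction to lines *)

Lemma exists_nonroot (A : numDomainType) (p : {poly A}) :
  p != 0 -> exists t, p.[t] != 0.
Proof.
move=> p0; pose s := [seq i%:R : A | i <- iota 0 (size p)].
have us : uniq s by rewrite map_inj_uniq ?iota_uniq //; apply: mulrIn; rewrite oner_eq0.
have : ~~ all (root p) s.
  apply/negP => /(max_poly_roots p0)/(_ us).
  by rewrite size_map size_iota ltnn.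
by case/allPn => t _ pt; exists t.
Qed.

Lemma poly_ext (A : numDomainType) (p q : {poly A}) :
  (forall t, p.[t] = q.[t]) -> p = q.
Proof.
move=> pq; apply/eqP; rewrite -subr_eq0; apply: contraT => /exists_nonroot[t].
by rewrite hornerD hornerN pq subrr eqxx.
Qed.

Lemma horner2_map (A : comNzRingType) (c : {poly {poly A}}) (x y : A) :
  c.[x, y] = (map_poly (horner_eval y) c).[x].
Proof.
by rewrite -[X in _ = _.[X]](hornerC x y) -/(horner_eval y x%:P) horner_map.
Qed.

(** The restriction to a parametrized line is kept as a polynomial, so that vanishing at the base
    point becomes divisibility by 'X and directional derivatives become formal ones. *)
Definition line_poly (A : comNzRingType) (x y a b : A) (c : {poly {poly A}}) :
  {poly A} := (map_poly (comp_poly (y%:P + b *: 'X)) c).[x%:P + a *: 'X].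

Lemma line_polyE (A : comNzRingType) (x y a b h : A) (c : {poly {poly A}}) :
  (line_poly x y a b c).[h] = c.[x + a * h, y + b * h].
Proof.
rewrite /line_poly -/(horner_eval h _) -horner_map -map_poly_comp /=.
have l_h u v : horner_eval h (u%:P + v *: 'X) = u + v * h.
  by rewrite /horner_eval hornerD hornerC hornerZ hornerX.
rewrite l_h horner2_map; congr (_.[_]).
by apply: eq_map_poly => p /=; rewrite /horner_eval horner_comp -/(horner_eval h _) l_h.
Qed.

Lemma line_polyM (A : comNzRingType) (x y a b : A) (c1 c2 : {poly {poly A}}) :
  line_poly x y a b (c1 * c2) = line_poly x y a b c1 * line_poly x y a b c2.
Proof. by rewrite /line_poly rmorphM hornerM. Qed.

(** Chain rule: the outer derivative is the partial derivative in x, the coefficientwise one that in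
    y. *)
Lemma deriv_line_poly (A : comNzRingType) (x y a b : A) (c : {poly {poly A}}) :
  (line_poly x y a b c)^`() = a *: line_poly x y a b c^`()
    + b *: line_poly x y a b (map_poly deriv c).
Proof.
rewrite /line_poly; elim/poly_ind: c => [|c p IHc].
  by rewrite deriv0 !raddf0 !horner0 deriv0 !scaler0 addr0.
have dl u v : (u%:P + v *: 'X)^`() = v%:P :> {poly A}.
  by rewrite derivD derivC derivZ derivX add0r alg_polyC.
have -> : map_poly deriv (c * 'X + p%:P) = map_poly deriv c * 'X + (p^`())%:P.
  apply/polyP => i; rewrite coef_map /= !coefD !coefMX !coefC.
  by case: i => [|i] /=; rewrite ?coef_map /= ?add0r ?addr0 ?derivD ?deriv0 ?addr0.
rewrite !derivD !derivM derivX derivC addr0 mulr1 /=.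
rewrite !rmorphD /= !rmorphM /= !map_polyC /= !map_polyX !hornerE.
rewrite !derivD !derivM IHc dl deriv_comp dl -!mul_polyC.
by ring.
Qed.

Lemma map_line_poly (A B : comNzRingType) (f : {rmorphism A -> B}) (x y a b : A)
    (c : {poly {poly A}}) :
  map_poly f (line_poly x y a b c) =
  line_poly (f x) (f y) (f a) (f b) (map_poly (map_poly f) c).
Proof.
have fl u v : map_poly f (u%:P + v *: 'X) = (f u)%:P + f v *: 'X.
  by rewrite rmorphD /= map_polyC map_polyZ map_polyX.
rewrite /line_poly -horner_map -!fl; congr (_.[_]).
rewrite -!map_poly_comp; apply: eq_map_poly => p /=.
by rewrite map_comp_poly fl.
Qed.

(** * Contents in t and evaluation at a point of the plane *)

Lemma eval_to_tpoly (R : fieldType) (F : {poly {poly {poly R}}}) (x y : R) :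
  map_poly (horner_eval y \o horner_eval x%:P) (to_tpoly F) =
  F.[x%:P%:P].[y%:P].
Proof.
rewrite /to_tpoly; set G := map_poly _ F.
transitivity (map_poly (horner_eval y) (map_poly (horner_eval x%:P) (swapXY G))).
  by rewrite -map_poly_comp.
have xE : swapXY (x%:P%:P : {poly {poly R}}) = x%:P%:P by rewrite swapXY_polyC map_polyC.
by rewrite -horner_polyC -[X in G.[X]]xE horner_map /= -horner_polyC.
Qed.

Lemma tcontent_dvd (R : fieldType) (F : {poly {poly {poly R}}}) (i j : nat) :
  tcontent F %| F`_i`_j.
Proof.
have gcd_dvd (T : eqType) (f : T -> {poly R}) (s : seq T) x :
    x \in s -> \big[@gcdp R/0]_(c <- s) f c %| f x.
  elim: s => //= c s IHs; rewrite inE big_cons => /orP[/eqP->|/IHs xs].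
    exact: dvdp_gcdl.
  exact: dvdp_trans (dvdp_gcdr _ _) xs.
have [ij|ji] := ltnP j (size F`_i); last by rewrite nth_default ?dvdp0.
have [iF|Fi] := ltnP i (size F); last by rewrite nth_default ?size_poly0 in ij.
apply: dvdp_trans (gcd_dvd _ id _ _ (mem_nth 0 ij)).
exact: (gcd_dvd _ (fun G : {poly {poly R}} => \big[@gcdp R/0]_(c <- G) c)
  _ _ (mem_nth 0 iF)).
Qed.

Lemma tcontentK (R : fieldType) (F : {poly {poly {poly R}}}) :
  (tcontent F)%:P%:P * tprimitive F = F.
Proof.
apply/polyP => i; apply/polyP => j; rewrite !coefCM.
rewrite coef_map_id0 ?coef_map_id0 ?div0p //; last first.
  by apply/polyP => k; rewrite coef_map_id0 ?coef0 ?div0p.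
by rewrite mulrC divpK // tcontent_dvd.
Qed.

Lemma eval_tprimitive (R : fieldType) (F : {poly {poly {poly R}}}) (x y : R) :
  tcontent F * map_poly (horner_eval y \o horner_eval x%:P)
                 (to_tpoly (tprimitive F)) = F.[x%:P%:P].[y%:P].
Proof. by rewrite eval_to_tpoly -{3}[F]tcontentK !hornerM !hornerC. Qed.

(** * Normal lines and circles as specializations of P and Q *)

Section NormalLines.
Variables (R : realType) (X Y W : {poly R}) (d : R).

Local Notation U := (Upol X W).
Local Notation V := (Vpol Y W).
Local Notation G := (gcdp U V).
Local Notation Uh := (Uhat X Y W).
Local Notation Vh := (Vhat X Y W).

(* Up to the factor W(t) resp. W(t)^2, these express at t that (x, y) lies on *)
(* the normal of the curve at phi(t), resp. at distance d from phi(t).        *)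
Definition normal_line (x y : R) : {poly R} :=
  Uh * (W * x%:P - X) + Vh * (W * y%:P - Y).

Definition offset_circle (x y : R) : {poly R} :=
  (W * x%:P - X) ^+ 2 + (W * y%:P - Y) ^+ 2 - d ^+ 2 *: W ^+ 2.

Lemma normal_lineE x y t : (normal_line x y).[t] =
  Uh.[t] * (W.[t] * x - X.[t]) + Vh.[t] * (W.[t] * y - Y.[t]).
Proof. by rewrite hornerD !hornerM !hornerD !hornerN !hornerM !hornerC. Qed.

Lemma offset_circleE x y t : (offset_circle x y).[t] =
  (W.[t] * x - X.[t]) ^+ 2 + (W.[t] * y - Y.[t]) ^+ 2 - d ^+ 2 * W.[t] ^+ 2.
Proof.
rewrite hornerD hornerN hornerZ horner_exp hornerD !horner_exp.
by rewrite !hornerD !hornerN !hornerM !hornerC.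
Qed.

Local Notation ev x y := (horner_eval y \o horner_eval x%:P).
Local Notation Pev x y := (map_poly (ev x y) (Ppol X Y W)).
Local Notation Qev x y := (map_poly (ev x y) (Qpol X Y W d)).

Lemma Uhat_mul : U = Uh * G. Proof. by rewrite divpK ?dvdp_gcdl. Qed.
Lemma Vhat_mul : V = Vh * G. Proof. by rewrite divpK ?dvdp_gcdr. Qed.

Lemma Ptilde_eval x y : (Ptilde X Y W).[x%:P%:P].[y%:P] = G * normal_line x y.
Proof.
rewrite /normal_line mulrDr !mulrA ![G * _]mulrC -Uhat_mul -Vhat_mul.
by rewrite /Ptilde !hornerE.
Qed.

Lemma Qtilde_eval x y : (Qtilde X Y W d).[x%:P%:P].[y%:P] = offset_circle x y.
Proof. by rewrite /Qtilde !hornerE. Qed.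

(** This form exposes the coefficients U W of x and V W of y, both of which the content divides. *)
Lemma Ptilde_coefE : Ptilde X Y W =
  (U * W)%:P%:P * 'X + ((V * W)%:P * 'X + (- (U * X + V * Y))%:P)%:P.
Proof.
rewrite /Ptilde; move: U V => u v.
rewrite !polyCD !polyCN !polyCD !polyCM.
move: (u%:P%:P) (v%:P%:P) (W%:P%:P) (X%:P%:P) (Y%:P%:P) ('X%:P) 'X => a b w x y z t.
by ring.
Qed.

Lemma Qtilde_coefE : Qtilde X Y W d =
  (W ^+ 2)%:P%:P * 'X^2 + (- (W * X + W * X))%:P%:P * 'X
  + ((W%:P * 'X - Y%:P) ^+ 2 + (X ^+ 2 - d ^+ 2 *: W ^+ 2)%:P)%:P.
Proof.
rewrite /Qtilde !polyCD !polyCN !polyCD !polyC_exp !polyCD !polyCN !polyCM.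
move: (W%:P%:P) (X%:P%:P) (Y%:P%:P) ('X%:P) (d ^+ 2 *: W ^+ 2)%:P%:P 'X => w x y z e t.
by rewrite !expr2; ring.
Qed.

Lemma tcontent_Ptilde : G != 0 -> W != 0 ->
  tcontent (Ptilde X Y W) != 0 /\
  exists k, G * W = k * tcontent (Ptilde X Y W).
Proof.
move=> G0 W0; set c := tcontent _.
have cU : c %| U * W.
  have := tcontent_dvd (Ptilde X Y W) 1 0.
  by rewrite -/c Ptilde_coefE coefD coefCM coefX coefC /= mulr1 addr0 coefC.
have cV : c %| V * W.
  have := tcontent_dvd (Ptilde X Y W) 0 1.
  rewrite -/c Ptilde_coefE coefD coefCM coefX coefC /= mulr0 add0r.
  by rewrite coefD coefCM coefX coefC /= mulr1 addr0.
have cG : c %| G * W.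
  have : c %| gcdp (U * W) (V * W) by rewrite dvdp_gcd cU cV.
  by rewrite (eqp_dvdr _ (gcdp_mul2r _ _ _)).
split; last by have [k ->] := dvdpP _ _ cG; exists k.
by apply: contraTneq cG => ->; rewrite dvd0p mulf_neq0.
Qed.

(** If c is the content of [Ptilde] and G W = k c, then W P = k H for the reduced normal line H.
    Zeros of H thus pass to P wherever W is nonzero, even at a t where G vanishes. *)
Lemma Pev_root x y t : G != 0 -> W.[t] != 0 ->
  (normal_line x y).[t] = 0 -> (Pev x y).[t] = 0.
Proof.
move=> G0 Wt Ht; have W0 : W != 0 by apply: contraNneq Wt => ->; rewrite horner0.
have [c0 [k kE]] := tcontent_Ptilde G0 W0.
have cP := eval_tprimitive (Ptilde X Y W) x y.
rewrite Ptilde_eval -/(Ppol X Y W) in cP.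
have : W * Pev x y = k * normal_line x y.
  by apply: (mulfI c0); rewrite mulrCA cP mulrA [W * G]mulrC kE; ring.
move/(congr1 (fun p => p.[t])); rewrite !hornerM Ht mulr0 => /eqP.
by rewrite mulf_eq0 (negPf Wt) => /eqP.
Qed.

Lemma Pev_eq0 x y : Pev x y = 0 -> G != 0 -> normal_line x y = 0.
Proof.
move=> P0 G0; have := eval_tprimitive (Ptilde X Y W) x y.
rewrite Ptilde_eval -/(Ppol X Y W) P0 mulr0 => /esym/eqP.
by rewrite mulf_eq0 (negPf G0) => /eqP.
Qed.

Lemma tcontent_Qtilde : tcontent (Qtilde X Y W d) %| W ^+ 2.
Proof.
have Q2 : (Qtilde X Y W d)`_2 = (W ^+ 2)%:P.
  by rewrite Qtilde_coefE !coefD !coefCM coefXn coefX coefC /= mulr1 mulr0 !addr0.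
by have := tcontent_dvd (Qtilde X Y W d) 2 0; rewrite Q2 coefC.
Qed.

Lemma tcontent_Qtilde_neq0 t : W.[t] != 0 -> (tcontent (Qtilde X Y W d)).[t] != 0.
Proof.
apply: contra_neq => ct0; have [k] := dvdpP _ _ tcontent_Qtilde.
move/(congr1 (fun p => p.[t])); rewrite /= horner_exp hornerM ct0 mulr0 => /eqP.
by rewrite expf_eq0 => /andP[_ /eqP].
Qed.

Lemma Qev_mul x y : tcontent (Qtilde X Y W d) * Qev x y = offset_circle x y.
Proof. by rewrite -Qtilde_eval -eval_tprimitive. Qed.

(** For A = W x - X one has W A' = W' A - U, and likewise in y. Modulo [Qtilde], its t-derivative
    times W is therefore -2 [Ptilde], which turns common zeros into double roots. *)
Lemma deriv_offset_circle x y : W * (offset_circle x y)^`() =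
  2%:R * (W^`() * offset_circle x y - G * normal_line x y).
Proof.
have -> : G * normal_line x y = U * (W * x%:P - X) + V * (W * y%:P - Y).
  by rewrite -Ptilde_eval /Ptilde !hornerE.
rewrite /offset_circle /Upol /Vpol -!mul_polyC !expr2.
by rewrite !(derivB, derivD, derivM, derivC); ring.
Qed.

(** The content of [Qtilde] divides W^2, so it is nonzero at t and cancels without changing the
    multiplicity of the root. *)
Lemma Qev_double_root x y t : W.[t] != 0 ->
  (normal_line x y).[t] = 0 -> (offset_circle x y).[t] = 0 ->
  (Qev x y).[t] = 0 /\ (Qev x y)^`().[t] = 0.
Proof.
move=> Wt Ht Qt; have ct := tcontent_Qtilde_neq0 Wt.
have Qt' : (offset_circle x y)^`().[t] = 0.
  have := congr1 (fun p => p.[t]) (deriv_offset_circle x y).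
  move: (normal_line x y) (offset_circle x y) Ht Qt => p q Hp Hq.
  rewrite !(hornerM, hornerD, hornerN) Hp Hq !mulr0 subr0 mulr0 => /eqP.
  by rewrite mulf_eq0 (negPf Wt) => /eqP.
move: Qt Qt'; rewrite -Qev_mul derivM hornerM hornerD !hornerM => /eqP.
rewrite mulf_eq0 (negPf ct) => /eqP/= Q0; split=> //; move: Qt'.
by rewrite Q0 mulr0 add0r => /eqP; rewrite mulf_eq0 (negPf ct) => /eqP.
Qed.

(* The two points below are symmetric with respect to phi(t), hence generated *)
(* by t for the two choices of sign.                                          *)
Lemma opposite_point x y t (x' := 2%:R * (X.[t] / W.[t]) - x)
    (y' := 2%:R * (Y.[t] / W.[t]) - y) : W.[t] != 0 ->
  (normal_line x y).[t] = 0 -> (offset_circle x y).[t] = 0 ->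
  (normal_line x' y').[t] = 0 /\ (offset_circle x' y').[t] = 0.
Proof.
move=> Wt; rewrite !normal_lineE !offset_circleE => Ht Qt.
have op u w : W.[t] * (2%:R * (u / W.[t]) - w) - u = - (W.[t] * w - u) by field.
rewrite /x' /y' !op !mulrN -opprD Ht oppr0; split=> //.
by rewrite !sqrrN.
Qed.

Lemma sum_sqr_poly_eq0 (p q : {poly R}) : p ^+ 2 + q ^+ 2 = 0 -> p = 0 /\ q = 0.
Proof.
move=> pq.
have p0q0 t : p.[t] = 0 /\ q.[t] = 0.
  have /eqP := congr1 (fun r => r.[t]) pq.
  rewrite hornerD !horner_exp horner0 paddr_eq0 ?sqr_ge0 // !expf_eq0 /=.
  by move=> /andP[/eqP -> /eqP ->].
by split; apply: poly_ext => t; have [] := p0q0 t; rewrite horner0.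
Qed.

Lemma offset_circle_dist x y t : W.[t] != 0 -> (offset_circle x y).[t] = 0 ->
  (x - X.[t] / W.[t]) ^+ 2 + (y - Y.[t] / W.[t]) ^+ 2 = d ^+ 2.
Proof.
rewrite offset_circleE => Wt Qt.
apply: (mulfI (expf_neq0 2 Wt)); apply/eqP; rewrite -subr_eq0; apply/eqP.
by rewrite -[RHS]Qt; field.
Qed.

Hypothesis G_neq0 : G != 0.

Lemma not_const_param (a b : R) : X = W * a%:P -> Y = W * b%:P -> False.
Proof.
move=> XE YE; case/negP: G_neq0; rewrite gcdp_eq0 /Upol /Vpol XE YE.
rewrite !derivM !derivC !mulr0 !addr0; apply/andP; split; apply/eqP; ring.
Qed.

(** A polynomial of degree at most 1 with a double root is zero. If Q had such a degree in t, the
    circle equation would hold for all parameters at (x, y) and at its mirror image in phi(t). By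
    the parallelogram law the sum of the two equations makes the curve a single point. *)
Lemma size_Qpol x y t : W.[t] != 0 ->
  (normal_line x y).[t] = 0 -> (offset_circle x y).[t] = 0 ->
  (2 < size (Qpol X Y W d))%N.
Proof.
move=> Wt Ht Qt; rewrite ltnNge; apply/negP => szQ.
have Q0 x1 y1 : (normal_line x1 y1).[t] = 0 -> (offset_circle x1 y1).[t] = 0 ->
    offset_circle x1 y1 = 0.
  move=> H1 Q1; have [Qt0 Qt1] := Qev_double_root Wt H1 Q1.
  rewrite -Qev_mul; move: Qt0 Qt1.
  have : (size (Qev x1 y1) <= 2)%N by exact: leq_trans (size_poly _ _) szQ.
  set q := Qev _ _ => sq.
  have qE : q = (q`_0)%:P + (q`_1)%:P * 'X.
    apply/polyP => i; rewrite coefD coefC coefCM coefX.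
    case: i => [|[|i]] /=; rewrite ?mulr0 ?mulr1 ?addr0 ?add0r //.
    by rewrite nth_default // (leq_trans sq).
  rewrite {}qE derivD derivC derivM derivC derivX !hornerE => q0 q1.
  by move: q0; rewrite q1 mul0r addr0 => ->; rewrite !polyC0 mul0r addr0 mulr0.
have [Ht' Qt'] := opposite_point Wt Ht Qt.
have := Q0 _ _ Ht Qt; have := Q0 _ _ Ht' Qt'.
set a := X.[t] / W.[t]; set b := Y.[t] / W.[t].
have Qab := offset_circle_dist Wt Qt.
move=> /esym Q2 /esym Q1.
have [|p0 q0] := @sum_sqr_poly_eq0 (W * a%:P - X) (W * b%:P - Y).
  have : offset_circle (2%:R * a - x) (2%:R * b - y) + offset_circle x y = 0.
    by rewrite -Q1 -Q2 addr0.
  rewrite /offset_circle -!mul_polyC -Qab.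
  rewrite !(polyCB, polyCD, polyCM, polyC_exp) => sum0.
  apply: (@mulfI _ 2%:R%:P); first by rewrite polyC_eq0 pnatr_eq0.
  by rewrite mulr0 -[RHS]sum0; ring.
by apply: (@not_const_param a b); apply/eqP; rewrite eq_sym -subr_eq0 ?p0 ?q0.
Qed.

(** If P were constant in t, every normal would pass through both (x, y) and its mirror image in
    phi(t), hence would be the same line with direction (e, f). The curve would lie on that line and
    yet be orthogonal to it, so U = V = 0. *)
Lemma size_Ppol x y t : d != 0 -> W.[t] != 0 ->
  (normal_line x y).[t] = 0 -> (offset_circle x y).[t] = 0 ->
  (1 < size (Ppol X Y W))%N.
Proof.
move=> d0 Wt Ht Qt; rewrite ltnNge; apply/negP => szP.
have W0 : W != 0 by apply: contraNneq Wt => ->; rewrite horner0.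
have P0 x1 y1 : (normal_line x1 y1).[t] = 0 -> normal_line x1 y1 = 0.
  move=> H1; have := Pev_root G_neq0 Wt H1.
  have /size1_polyC PE : (size (Pev x1 y1) <= 1)%N by exact: leq_trans (size_poly _ _) szP.
  rewrite PE hornerC => Pt0; apply: Pev_eq0 G_neq0.
  by rewrite PE Pt0.
have [Ht' Qt'] := opposite_point Wt Ht Qt.
have := P0 _ _ Ht; have := P0 _ _ Ht'; have := offset_circle_dist Wt Qt.
set a := X.[t] / W.[t]; set b := Y.[t] / W.[t].
set e := x - a; set f := y - b => ef.
have -> : 2%:R * a - x = a - e by rewrite /e; ring.
have -> : 2%:R * b - y = b - f by rewrite /f; ring.
have -> : x = a + e by rewrite /e; ring.
have -> : y = b + f by rewrite /f; ring.
clearbody e f a b; rewrite /normal_line !polyCD !polyCN => H2 H1.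
pose u := W * a%:P - X; pose v := W * b%:P - Y.
have two0 : (2%:R : {poly R}) != 0 by rewrite -polyCMn polyC_eq0 pnatr_eq0.
have uv : Uh * u + Vh * v = 0.
  apply: (mulfI two0); rewrite mulr0 -[RHS]addr0 -[X in _ = X + _]H1 -H2 /u /v.
  by move: Uh Vh => p q; ring.
have efh : Uh * e%:P + Vh * f%:P = 0.
  apply: (mulfI W0); apply: (mulfI two0).
  rewrite !mulr0 -[RHS]subr0 -[X in _ = X - _]H1 -H2.
  by move: Uh Vh => p q; ring.
have eUfV : e%:P * U + f%:P * V = 0.
  rewrite -(mul0r G) -efh mulrDl ![_ * G]mulrAC -Uhat_mul -Vhat_mul.
  by rewrite [U * _]mulrC [V * _]mulrC.
have Uh0 : (Uh != 0) || (Vh != 0).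
  rewrite -negb_and; apply: contraNN G_neq0 => /andP[/eqP p0 /eqP q0].
  have U0 : U = 0 by rewrite Uhat_mul p0 mul0r.
  have V0 : V = 0 by rewrite Vhat_mul q0 mul0r.
  by rewrite U0 V0 gcdp0.
(* Both (u, v) and (e, f) are orthogonal to the nonzero vector ([Uhat], [Vhat]), hence parallel. *)
have K0 : e%:P * v - f%:P * u = 0.
  case/orP: Uh0 => h0; apply: (mulfI h0); rewrite mulr0.
  - rewrite -[RHS](mul0r v) -efh -[LHS]addr0 -[X in _ + X](mulr0 f%:P) -uv.
    by move: Uh Vh => p q; ring.
  - rewrite -[RHS](mul0r (- u)) -efh -[LHS]subr0 -[X in _ - X](mulr0 e%:P) -uv.
    by move: Uh Vh => p q; ring.
(* Up to the factor -W^2, this is the derivative of (e v - f u) / W. *)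
have eVfU : e%:P * V - f%:P * U = 0.
  transitivity (W^`() * (e%:P * v - f%:P * u) - W * (e%:P * v - f%:P * u)^`()).
    by rewrite /u /v !(derivB, derivM, derivC) /Upol /Vpol; ring.
  by rewrite K0 deriv0 !mulr0 subr0.
have ef0 : (e%:P ^+ 2 + f%:P ^+ 2 : {poly R}) != 0.
  by rewrite -!polyC_exp -polyCD polyC_eq0 ef expf_eq0.
case/negP: G_neq0; rewrite gcdp_eq0; apply/andP; split; apply/eqP; apply: (mulfI ef0).
- transitivity (e%:P * (e%:P * U + f%:P * V) - f%:P * (e%:P * V - f%:P * U)).
    by move: U V => p q; ring.
  by rewrite eUfV eVfU !mulr0 subr0.
- transitivity (f%:P * (e%:P * U + f%:P * V) + e%:P * (e%:P * V - f%:P * U)).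
    by move: U V => p q; ring.
  by rewrite eUfV eVfU !mulr0 addr0.
Qed.

End NormalLines.

(** * Nonconstancy of proper parametrizations, and normals of given length *)

Lemma wronskian_eq0 (A : numFieldType) (p w : {poly A}) : w != 0 ->
  p^`() * w = p * w^`() -> exists c, p = w * c%:P.
Proof.
move=> w0 pw; have [t wt] := exists_nonroot w0.
pose c := p.[t] / w.[t]; pose u := p - w * c%:P.
have ut : u.[t] = 0.
  by rewrite hornerD hornerN hornerM hornerC mulrCA divff // mulr1 subrr.
have uw : u^`() * w = u * w^`().
  rewrite /u !(derivB, derivM, derivC) mulr0 addr0 mulrBl pw.
  by move: w^`() => w'; ring.
exists c; apply/eqP; rewrite -subr_eq0 -/u; apply: contraT => u0.
have [m [q]] := multiplicity_XsubC u t; rewrite u0 /= => qt uE.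
case: m => [|m] in uE; first by rewrite uE mulr1 in ut; rewrite /root ut eqxx in qt.
have L0 : ('X - t%:P) ^+ m != 0 by rewrite expf_neq0 // polyXsubC_eq0.
(* Substituting u = ('X - t)^(m+1) q and cancelling ('X - t)^m leaves a relation whose value at t is
   (m+1) q(t) w(t), which is nonzero. *)
have : ('X - t%:P) * (q^`() * w - q * w^`()) + m.+1%:R * (q * w) = 0.
  apply: (mulfI L0); rewrite mulr0 -[RHS](subrr (u^`() * w)) {2}uw uE.
  rewrite derivM deriv_exp derivXsubC mul1r /= exprS.
  rewrite -[_ ^+ m *+ _]mulr_natl; move: (_ ^+ m) (m.+1%:R) => l k.
  by ring.
move/(congr1 (fun r => r.[t])); rewrite hornerD hornerM hornerXsubC subrr mul0r add0r.
rewrite -polyCMn hornerM hornerC hornerM horner0 => /eqP.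
rewrite mulf_eq0 pnatr_eq0 /= mulf_eq0 (negPf wt).
by rewrite orbF -/(root q t) (negPf qt).
Qed.

(** Orthogonality gives (e, f) = l (q, -p), and comparing lengths gives l^2 (p^2 + q^2) = d^2. Then
    alpha = d / l, its sign being that of the branch. *)
Lemma unit_normal_exists (A : realFieldType) (p q e f d : A) : d != 0 ->
  (p != 0) || (q != 0) -> p * e + q * f = 0 -> e ^+ 2 + f ^+ 2 = d ^+ 2 ->
  exists alpha, [/\ alpha ^+ 2 = p ^+ 2 + q ^+ 2,
    e = d * (q / alpha) & f = - (d * (p / alpha))].
Proof.
move=> d0 pq0 pe ef.
have n0 : p ^+ 2 + q ^+ 2 != 0.
  by rewrite paddr_eq0 ?sqr_ge0 // !expf_eq0 /= negb_and.
pose l := (e * q - f * p) / (p ^+ 2 + q ^+ 2).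
have eE : e = l * q.
  apply: (mulIf n0); rewrite /l -[RHS]subr0 -[X in _ = _ - X](mul0r (- p)) -pe.
  by field.
have fE : f = - (l * p).
  apply: (mulIf n0); rewrite /l -[RHS]subr0 -[X in _ = _ - X](mul0r (- q)) -pe.
  by field.
have ld : l ^+ 2 * (p ^+ 2 + q ^+ 2) = d ^+ 2 by rewrite -ef eE fE; ring.
have l0 : l != 0.
  by apply: contra_neq d0 => l0; apply/eqP; rewrite -sqrf_eq0 -ld l0 expr0n mul0r.
exists (d / l); split.
- by rewrite expr_div_n -ld mulrC mulKf // sqrf_eq0.
- by rewrite eE; field; rewrite d0 l0.
- by rewrite fE; field; rewrite d0 l0.
Qed.

Section Generated.
Variables (R : realType) (X Y W : {poly R}) (d : R).

Local Notation U := (Upol X W).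
Local Notation V := (Vpol Y W).
Local Notation G := (gcdp U V).

(** If U = V = 0, then phi is constant, and any two distinct parameters outside [s] and the zeros of
    W contradict injectivity. *)
Lemma proper_gcd_neq0 : W != 0 -> proper_param X Y W -> G != 0.
Proof.
move=> W0 [s inj]; apply: contraTneq isT => /eqP.
rewrite gcdp_eq0 /Upol /Vpol !subr_eq0 => /andP[/eqP UE /eqP VE].
have [a XE] := wronskian_eq0 W0 UE; have [b YE] := wronskian_eq0 W0 VE.
have evalCM c t : evalC W t != 0 -> evalC (W * c%:P) t / evalC W t = real_complex R c.
  by move=> Wt; rewrite /evalC rmorphM /= map_polyC hornerM hornerC mulrAC divff ?mul1r.
pose p := map_poly (real_complex R) W * \prod_(z <- s) ('X - z%:P).
have p0 : p != 0 by rewrite mulf_neq0 ?map_poly_eq0 // monic_neq0 // monic_prod_XsubC.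
have good t : p.[t] != 0 -> t \notin s /\ evalC W t != 0.
  rewrite hornerM mulf_eq0 negb_or => /andP[Wt].
  by rewrite -/(root _ t) root_prod_XsubC.
have [t1 pt1] := exists_nonroot p0.
have [|t2] := @exists_nonroot _ (p * ('X - t1%:P)).
  by rewrite mulf_neq0 // polyXsubC_eq0.
rewrite hornerM hornerXsubC mulf_eq0 negb_or subr_eq0 => /andP[pt2 t12].
have [st1 Wt1] := good _ pt1; have [st2 Wt2] := good _ pt2.
case/eqP: t12; apply/esym/inj => //.
- by rewrite XE !evalCM.
- by rewrite YE !evalCM.
Qed.

Lemma Uhat_Vhat_neq0 t : G != 0 ->
  ((Uhat X Y W).[t] != 0) || ((Vhat X Y W).[t] != 0).
Proof.
move=> G0; have cop : coprimep (Uhat X Y W) (Vhat X Y W).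
  by apply: coprimep_div_gcd; rewrite -negb_and -gcdp_eq0.
by have [Ut|//] := eqVneq (Uhat X Y W).[t] 0; apply: (coprimep_root cop); rewrite /root Ut.
Qed.

End Generated.

(** * Generated points lie on the normal and on the circle *)

Section GeneratedPoints.
Variables (R : realType) (X Y W : {poly R}) (d : R).

Local Notation U := (Upol X W).
Local Notation V := (Vpol Y W).

Definition on_normal_circle (x y t : R) :=
  (normal_line X Y W x y).[t] = 0 /\ (offset_circle X Y W d x y).[t] = 0.

Lemma offset_map_normal_circle neg t : U.[t] ^+ 2 + V.[t] ^+ 2 != 0 -> W.[t] != 0 ->
  on_normal_circle (offset_map X Y W d neg t).1 (offset_map X Y W d neg t).2 t.
Proof.
move=> N0 Wt; rewrite /on_normal_circle normal_lineE offset_circleE /offset_map /=.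
set r := Num.sqrt _; set e := (-1) ^+ neg.
have r2 : r ^+ 2 = U.[t] ^+ 2 + V.[t] ^+ 2.
  by rewrite sqr_sqrtr // addr_ge0 // sqr_ge0.
have r0 : r != 0 by rewrite -sqrf_eq0 r2.
have e2 : e ^+ 2 = 1 by rewrite sqrr_sign.
clearbody r e.
have lx : W.[t] * (X.[t] / W.[t] + e * d * (V.[t] / r)) - X.[t] =
    W.[t] * (e * d / r) * V.[t] by field; rewrite Wt r0.
have ly : W.[t] * (Y.[t] / W.[t] - e * d * (U.[t] / r)) - Y.[t] =
    - (W.[t] * (e * d / r) * U.[t]) by field; rewrite Wt r0.
rewrite lx ly; split.
(* Both sides equal Uhat Vhat G, so (V, -U) is orthogonal to ([Uhat], [Vhat]). *)
- have UVh : (Uhat X Y W).[t] * V.[t] = (Vhat X Y W).[t] * U.[t].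
    rewrite -!hornerM [in LHS](Vhat_mul X Y W) [in RHS](Uhat_mul X Y W).
    by congr (_.[_]); ring.
  rewrite mulrN mulrCA UVh; move: (Vhat X Y W).[t] U.[t] => p q.
  by ring.
- rewrite sqrrN !exprMn -mulrDr [V.[t] ^+ 2 + _]addrC -r2 exprVn e2 mul1r.
  move: {lx ly e2} (d ^+ 2) (W.[t] ^+ 2) (r ^+ 2) (expf_neq0 2 r0) => D w r2' r20.
  by field.
Qed.

(** The two equations are polynomial in the point and the parameter, so they pass to limits. An
    abstract filter [F] serves both one-sided limits. *)
Lemma on_normal_circle_limit (F : set_system R) (FF : ProperFilter F) (t x y : R) neg :
  gcdp U V != 0 -> W.[t] != 0 ->
  (fun s => s) @ F --> t -> (\forall s \near F, s != t) ->
  offset_map X Y W d neg s @[s --> F] --> (x, y) ->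
  on_normal_circle x y t.
Proof.
move=> G0 Wt Ft Fneq lim.
have hornF p : p.[s] @[s --> F] --> p.[t].
  by apply: (cvg_comp _ _ Ft); exact: continuous_horner.
have nearF p : p.[t] != 0 -> \forall s \near F, p.[s] != 0.
  by move=> pt; apply: (cvgr_neq0 p.[t]) => //; exact: hornF.
have [N0|] := eqVneq (U ^+ 2 + V ^+ 2) 0.
  have [U0 V0] := sum_sqr_poly_eq0 N0.
  by move: G0; rewrite gcdp_eq0 U0 V0 eqxx.
(* Splitting off the full power of 'X - t shows that U^2 + V^2 has no other zero near t, so the
   explicit formula applies there. *)
move=> N0; have [m [q]] := multiplicity_XsubC (U ^+ 2 + V ^+ 2) t.
rewrite N0 /= => qt NE.
have good : \forall s \near F, on_normal_circle (offset_map X Y W d neg s).1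
    (offset_map X Y W d neg s).2 s.
  apply: filterS3 Fneq (nearF _ Wt) (nearF _ qt) => s st Ws qs.
  apply: offset_map_normal_circle => //.
  have -> : U.[s] ^+ 2 + V.[s] ^+ 2 = (U ^+ 2 + V ^+ 2).[s].
    by rewrite [in RHS]hornerD !horner_exp.
  by rewrite NE hornerM mulf_neq0 // horner_exp hornerXsubC expf_neq0 // subr_eq0.
have limx : (offset_map X Y W d neg s).1 @[s --> F] --> x := cvg_comp _ _ lim cvg_fst.
have limy : (offset_map X Y W d neg s).2 @[s --> F] --> y := cvg_comp _ _ lim cvg_snd.
have fx p w : (p.[s] * (offset_map X Y W d neg s).1 - w.[s]) @[s --> F] --> p.[t] * x - w.[t].
  apply: cvgB; [apply: cvgM; [exact: hornF|exact: limx]|exact: hornF].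
have fy p w : (p.[s] * (offset_map X Y W d neg s).2 - w.[s]) @[s --> F] --> p.[t] * y - w.[t].
  apply: cvgB; [apply: cvgM; [exact: hornF|exact: limy]|exact: hornF].
split.
- have lim0 : ((Uhat X Y W).[s] * (W.[s] * (offset_map X Y W d neg s).1 - X.[s])
      + (Vhat X Y W).[s] * (W.[s] * (offset_map X Y W d neg s).2 - Y.[s]))
      @[s --> F] --> (0 : R).
    by apply: cvg_near_cst; apply: filterS good => s []; rewrite normal_lineE.
  rewrite normal_lineE; apply: (cvg_unique _ _ lim0); first exact: norm_hausdorff.
  by apply: cvgD; (apply: cvgM; first exact: hornF); [exact: fx|exact: fy].
- have lim0 : ((W.[s] * (offset_map X Y W d neg s).1 - X.[s]) *
      (W.[s] * (offset_map X Y W d neg s).1 - X.[s])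
      + (W.[s] * (offset_map X Y W d neg s).2 - Y.[s]) *
      (W.[s] * (offset_map X Y W d neg s).2 - Y.[s])
      - d ^+ 2 * (W.[s] * W.[s])) @[s --> F] --> (0 : R).
    by apply: cvg_near_cst; apply: filterS good => s [_]; rewrite offset_circleE !expr2.
  rewrite offset_circleE; apply: (cvg_unique _ _ lim0); first exact: norm_hausdorff.
  rewrite [W.[t] ^+ 2]expr2 ![(_ - _) ^+ 2]expr2; apply: cvgB; last first.
    by apply: cvgM; [exact: cvg_cst|apply: cvgM; exact: hornF].
  by apply: cvgD; apply: cvgM; (exact: fx || exact: fy).
Qed.

Lemma generated_normal_circle t x y : gcdp U V != 0 -> generated_by X Y W d t (x, y) ->
  W.[t] != 0 /\ on_normal_circle x y t.
Proof.
move=> G0 [Wt [neg]]; case: ifPn => [N0 xyE|_ lims]; split=> //.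
  by have := offset_map_normal_circle neg N0 Wt; rewrite -xyE.
case: lims => lim.
  apply: (on_normal_circle_limit _ G0 Wt _ _ lim).
    exact: cvg_within.
  near=> s; rewrite gt_eqF //; near: s; exact: nbhs_right_gt.
apply: (on_normal_circle_limit _ G0 Wt _ _ lim).
  exact: cvg_within.
near=> s; rewrite lt_eqF //; near: s; exact: nbhs_left_lt.
Unshelve. all: by end_near. Qed.

End GeneratedPoints.

(** * Contradiction at a singular point where sres_1 is nonzero *)

Lemma line_polyD (A : comNzRingType) (x y a b : A) (c1 c2 : {poly {poly A}}) :
  line_poly x y a b (c1 + c2) = line_poly x y a b c1 + line_poly x y a b c2.
Proof. by rewrite /line_poly rmorphD hornerD. Qed.

Lemma line_poly0 (A : comNzRingType) (x y a b : A) (c : {poly {poly A}}) :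
  (line_poly x y a b c).[0] = c.[x, y].
Proof. by rewrite line_polyE !mulr0 !addr0. Qed.

Lemma root0_mulX (A : comNzRingType) (p : {poly A}) :
  p.[0] = 0 -> exists q, p = q * 'X.
Proof.
by move/eqP/factor_theorem => [q ->]; exists q; rewrite subr0.
Qed.

Lemma double_root0_mulXX (A : idomainType) (p : {poly A}) :
  p.[0] = 0 -> p^`().[0] = 0 -> exists q, p = q * 'X * 'X.
Proof.
case/root0_mulX => q ->; rewrite derivM derivX mulr1 hornerD hornerMX mulr0 add0r.
by case/root0_mulX => q' ->; exists q'.
Qed.

Section RegularPoint.
Variables (R : realType) (X Y W : {poly R}) (d : R).

Local Notation ev x y := (horner_eval y \o horner_eval x%:P).
Local Notation P := (Ppol X Y W).
Local Notation Q := (Qpol X Y W d).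

Lemma horner_tpoly (p : {poly {poly {poly R}}}) (x y t : R) :
  (p.[t%:P%:P]).[x, y] = (map_poly (ev x y) p).[t].
Proof.
have evt : t = ev x y t%:P%:P by rewrite /= /horner_eval !hornerC.
by rewrite [in RHS]evt horner_map.
Qed.

Lemma sres1_eq0 (x y t : R) : gcdp (Upol X W) (Vpol Y W) != 0 -> d != 0 ->
  W.[t] != 0 -> on_normal_circle X Y W d x y t ->
  (forall g : {poly {poly R}}, (forall x1 y1 t1, W.[t1] != 0 ->
       on_normal_circle X Y W d x1 y1 t1 -> g.[x1, y1] = 0) ->
     forall a b, (line_poly x y a b g)^`().[0] = 0) ->
  (sres1 X Y W d).[x, y] = 0.
Proof.
move=> G0 d0 Wt [Ht Qt] grad0; apply/eqP; apply: contraT => s_xy.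
have szP := size_Ppol G0 d0 Wt Ht Qt; have szQ := size_Qpol G0 Wt Ht Qt.
set s := sres1 X Y W d in s_xy.
have s0 : s != 0 by apply: contraNneq s_xy => ->; rewrite !horner0.
(* The size bounds give n >= 1 and m >= 2, hence n + m >= 3. *)
have [u [v [r uv]]] : exists u v r, u * P + v * Q = s%:P * 'X + r%:P.
  by apply: Subres1_lead_ideal; rewrite ?leqSpred //; move: szP szQ; lia.
clearbody s.
have [k [q [g sQ]]] := linear_remainder Q r s0.
have sr x1 y1 t1 : W.[t1] != 0 -> on_normal_circle X Y W d x1 y1 t1 ->
    s.[x1, y1] * t1 + r.[x1, y1] = 0.
  move=> Wt1 [Ht1 Qt1].
  have := congr1 (fun p => p.[t1%:P%:P].[x1, y1]) uv.
  rewrite !hornerD !hornerM hornerX !hornerC => <-.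
  rewrite !horner_tpoly (Pev_root G0 Wt1 Ht1) (proj1 (Qev_double_root Wt1 Ht1 Qt1)).
  by rewrite !mulr0 addr0.
have sQt x1 y1 t1 : s.[x1, y1] ^+ k * (map_poly (ev x1 y1) Q).[t1] =
    (map_poly (ev x1 y1) q).[t1] * (s.[x1, y1] * t1 + r.[x1, y1]) + g.[x1, y1].
  have := congr1 (fun p => p.[t1%:P%:P].[x1, y1]) sQ.
  rewrite hornerZ !hornerD !hornerM hornerD hornerM hornerX !hornerC.
  by rewrite !horner_exp !horner_tpoly !hornerD !hornerM !hornerC.
have g0 x1 y1 t1 : W.[t1] != 0 -> on_normal_circle X Y W d x1 y1 t1 -> g.[x1, y1] = 0.
  move=> Wt1 on1; have [Ht1 Qt1] := on1; have := sQt x1 y1 t1.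
  by rewrite (sr _ _ _ Wt1 on1) mulr0 add0r (proj1 (Qev_double_root Wt1 Ht1 Qt1)) mulr0.
(* Differentiating s^k Q = q (s t + r) + g in t at the double root, where s t + r = 0, leaves 0 = q
   s. *)
have q_xyt : (map_poly (ev x y) q).[t] = 0.
  have sQ_xy : s.[x, y] ^+ k *: map_poly (ev x y) Q =
      map_poly (ev x y) q * (s.[x, y]%:P * 'X + r.[x, y]%:P) + g.[x, y]%:P.
    by apply: poly_ext => t1; rewrite hornerZ sQt !(hornerD, hornerM, hornerC, hornerX).
  have := congr1 (fun p => p^`().[t]) sQ_xy.
  rewrite derivZ hornerZ (proj2 (Qev_double_root Wt Ht Qt)) mulr0.
  rewrite derivD derivC addr0 derivM derivD derivC addr0 derivM derivC mul0r add0r derivX mulr1.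
  rewrite !(hornerD, hornerM, hornerC, hornerX) (sr _ _ _ Wt (conj Ht Qt)) mulr0 add0r.
  by move/esym/eqP; rewrite mulf_eq0 (negPf s_xy) orbF => /eqP.
(* The direction of the line is the radius vector from phi(t) to (x, y). *)
pose e := x - X.[t] / W.[t]; pose f := y - Y.[t] / W.[t].
pose L := line_poly x y e f.
have [A AE] : exists A, L q.[t%:P%:P] = A * 'X.
  by apply: root0_mulX; rewrite line_poly0 horner_tpoly.
have [B BE] : exists B, L (s * t%:P%:P + r) = B * 'X.
  apply: root0_mulX; rewrite line_poly0 !(hornerD, hornerM) !hornerC.
  exact: sr.
have [g2 gE] : exists g2, L g = g2 * 'X * 'X.
  apply: double_root0_mulXX; first by rewrite line_poly0 (g0 _ _ _ Wt).
  exact: grad0 g0 _ _.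
pose c := (tcontent (Qtilde X Y W d)).[t].
pose K := (W.[t] * d) ^+ 2.
(* At the point with line parameter h the distance from phi(t) is |1 + h| d, and (1 + h)^2 - 1 = (h
   + 2) h has a simple zero at h = 0. *)
have QE : c%:P * L Q.[t%:P%:P] = K%:P * ('X + 2%:R%:P) * 'X.
  apply: poly_ext => h; rewrite hornerM hornerC line_polyE horner_tpoly -hornerM Qev_mul.
  rewrite offset_circleE !hornerM hornerD !hornerC hornerX /K exprMn.
  rewrite -(offset_circle_dist Wt Qt) /e /f.
  by field.
(* On the right, [q], [s t + r] and [g] contribute a factor h^2. After cancelling one h, the value
   at h = 0 gives 2 s^k K = 0, which is impossible. *)
have : (L (s ^+ k) * K%:P * ('X + 2%:R%:P)) = c%:P * (A * B + g2) * 'X.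
  apply: (mulIf (negbT (polyX_eq0 R))).
  transitivity (c%:P * L (s ^+ k * Q.[t%:P%:P])).
    by rewrite /L line_polyM -/L mulrCA QE !mulrA.
  have -> : s ^+ k * Q.[t%:P%:P] = q.[t%:P%:P] * (s * t%:P%:P + r) + g.
    have := congr1 (fun p => p.[t%:P%:P]) sQ.
    by rewrite hornerZ hornerD hornerM hornerD hornerM hornerX !hornerC.
  by rewrite /L line_polyD line_polyM -/L AE BE gE; ring.
move/(congr1 (fun p => p.[0])); rewrite hornerMX mulr0 !hornerM hornerD hornerX add0r !hornerC.
move/eqP; rewrite !mulf_eq0 pnatr_eq0 orbF line_poly0 !horner_exp expf_eq0 (negPf s_xy) andbF /=.
by rewrite (negPf Wt) (negPf d0).
Qed.

End RegularPoint.

(** Over the complex numbers [g] vanishes on the Zariski closure, hence on all zeros of the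
    square-free equation [f], and so [f] divides it. As [f] and its gradient vanish at the point,
    the product rule gives the claim. *)
Lemma singular_deriv_line (R : realType) (X Y W : {poly R}) (d x y : R)
    (g : {poly {poly R}}) :
  singular (offset X Y W d) (toC2 (x, y)) ->
  (forall x1 y1 t1, generated_by X Y W d t1 (x1, y1) -> g.[x1, y1] = 0) ->
  forall a b, (line_poly x y a b g)^`().[0] = 0.
Proof.
move=> [f [[f0 sqf] offE off_xy fx fy]] g0 a b.
pose rc : {rmorphism R -> R[i]} := real_complex R.
pose gC := map_poly (map_poly rc) g.
have gCE x1 y1 : gC.[rc x1, rc y1] = rc g.[x1, y1].
  by rewrite /gC -(map_polyC rc) horner_map /= horner_map.
have [q gq] : exists q, gC = f * q.
  apply: square_free_dvd => // z1 z2 fz.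
  have : offset X Y W d (z1, z2) by rewrite offE.
  apply => _ [[x1 y1] [t1 gen1] <-].
  by rewrite /zeros /= gCE (g0 _ _ _ gen1) rmorph0.
have f_xy : f.[rc x, rc y] = 0 by move: off_xy; rewrite offE.
have dC : (line_poly (rc x) (rc y) (rc a) (rc b) gC)^`().[0] = 0.
  rewrite gq line_polyM derivM hornerD !hornerM deriv_line_poly hornerD !hornerZ.
  by rewrite !line_poly0 f_xy fx fy !mulr0 addr0 !mul0r addr0.
apply: (fmorph_inj rc); rewrite rmorph0 -[RHS]dC /gC -map_line_poly deriv_map.
by rewrite -[0 in RHS](rmorph0 rc) horner_map.
Qed.

Unset Implicit Arguments.
Set Strict Implicit.

Theorem theorem13 (R : realType) (X Y W : {poly R}) (d x0 y0 t0 : R)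
  (W_neq0 : W != 0)
  (gcdXYW : gcdp (gcdp X Y) W %= 1)
  (phi_proper : proper_param X Y W)
  (d_gt0 : 0 < d)
  (offset_irr : irreducible_set (offset X Y W d))
  (in_offset : offset X Y W d (toC2 (x0, y0)))
  (sing : singular (offset X Y W d) (toC2 (x0, y0)))
  (non_isol : non_isolated (offset X Y W d) (toC2 (x0, y0)))
  (gen : generated_by X Y W d t0 (x0, y0)) :
  exists alpha0 : R,
    [/\ alpha0 ^+ 2 = (Uhat X Y W).[t0] ^+ 2 + (Vhat X Y W).[t0] ^+ 2,
        (x0, y0) = (xmap X Y W d t0 alpha0, ymap X Y W d t0 alpha0) &
        (sres1 X Y W d).[xmap X Y W d t0 alpha0, ymap X Y W d t0 alpha0] = 0].
Proof.
have G0 := proper_gcd_neq0 W_neq0 phi_proper.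
have d0 : d != 0 by rewrite gt_eqF.
have [Wt [Ht Qt]] := generated_normal_circle G0 gen.
(* The normal equation divided by W(t0) makes the vector from phi(t0) to (x0, y0) orthogonal to
   ([Uhat], [Vhat]); its length is d. *)
have [alpha [alphaE xE yE]] : exists alpha : R,
    [/\ alpha ^+ 2 = (Uhat X Y W).[t0] ^+ 2 + (Vhat X Y W).[t0] ^+ 2,
      x0 - X.[t0] / W.[t0] = d * ((Vhat X Y W).[t0] / alpha) &
      y0 - Y.[t0] / W.[t0] = - (d * ((Uhat X Y W).[t0] / alpha))].
  apply: unit_normal_exists => //; [exact: Uhat_Vhat_neq0| |exact: offset_circle_dist].
  rewrite normal_lineE in Ht; rewrite -[RHS](mul0r W.[t0]^-1) -Ht.
  by field.
have x0E : x0 = xmap X Y W d t0 alpha by rewrite /xmap -xE addrC subrK.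
have y0E : y0 = ymap X Y W d t0 alpha by rewrite /ymap -yE addrC subrK.
exists alpha; rewrite -x0E -y0E; split=> //.
apply: (sres1_eq0 G0 d0 Wt (conj Ht Qt)) => g g0.
apply: singular_deriv_line sing _ => x1 y1 t1 gen1.
by have [Wt1 on1] := generated_normal_circle G0 gen1; apply: g0 Wt1 on1.
Qed.
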